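(* Let $T>0$, let $\alpha>0$ with $\alpha\in[n-1,n)$, $n\in\mathbb{N}$, and let $f\colon\mathbb{R}\to\mathbb{R}$ be continuous and $T$-periodic with $f\in AC^n(\mathbb{R})$. If the fractional integral $I^{n-\alpha}f$ is a bounded function, then the Caputo fractional derivative ${}^{C}D^\alpha f$ is an asymptotically $T$-periodic function.
   Context: Write $\mathbb{R}^+=[0,+\infty)$. For $\beta>0$, the fractional integral of order $\beta$ is $I^\beta h(t)=\dfrac{1}{\Gamma(\beta)}\displaystyle\int_0^t (t-s)^{\beta-1}h(s)\,ds$, $t>0$. $f\in AC^n(\mathbb{R})$ means that $f^{(n-1)}$ exists and is absolutely continuous on every compact interval. For $\alpha>0$ with $\alpha\in[n-1,n)$ and $f\in AC^n(\mathbb{R})$, the Caputo fractional derivative is ${}^{C}D^\alpha f(t)=I^{n-\alpha}f^{(n)}(t)$. $\mathcal{C}_0(\mathbb{R}^+,\mathbb{R})$ is the set of bounded continuous functions $h\colon\mathbb{R}^+\to\mathbb{R}$ with $\lim_{t\to\infty}|h(t)|=0$. A continuous function $\varphi$ on $\mathbb{R}^+$ is asymptotically $T$-periodic if there exist a continuous $T$-periodic function $f_1$ and a function $f_2\in\mathcal{C}_0(\mathbb{R}^+,\mathbb{R})$ such that $\varphi=f_1+f_2$ on $\mathbb{R}^+$.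
   Formalization: The formal theorem additionally assumes that the Caputo derivative is continuous on [0,∞) (with value 0 at t=0); for f merely in AC^n it can be unbounded on a compact interval, so the claim fails without this, and continuity is necessary for the conclusion. *)

(* Defs.v *)
From HB Require Import structures.
From mathcomp Require Export all_boot all_order all_algebra.
From mathcomp Require Export all_classical all_reals all_analysis.
Export Order.TTheory GRing.Theory Num.Theory.
Export numFieldNormedType.Exports.

Set Implicit Arguments.
Unset Strict Implicit.
Unset Printing Implicit Defensive.

Local Open Scope classical_set_scope.
Local Open Scope ring_scope.

Definition Gamma {R : realType} (b : R) : R :=
  (\int[@lebesgue_measure R]_(x in `]0%R, +oo[) (x `^ (b - 1) * expR (- x)))%R.

(* Lebesgue integral; its value is 0 for [t <= 0], and also for those [t]
   where the integral is infinite or undefined. *)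
Definition frac_integral {R : realType} (b : R) (h : R -> R) (t : R) : R :=
  (Gamma b)^-1 *
  (\int[@lebesgue_measure R]_(s in `[0%R, t]) ((t - s) `^ (b - 1) * h s))%R.

Definition abs_continuous_on {R : realType} (a b : R) (g : R -> R) : Prop :=
  forall e : R, 0 < e -> exists2 d : R, 0 < d &
    forall (m : nat) (u v : 'I_m -> R),
      (forall i, [/\ a <= u i, u i < v i & v i <= b]) ->
      trivIset setT (fun i => [set` `]u i, v i[]) ->
      \sum_(i < m) (v i - u i) < d ->
      \sum_(i < m) `|g (v i) - g (u i)| < e.

(* Meaningful for [0 < n]. The first clause says that the derivatives up to
   order [n.-1] exist everywhere; it is needed because [derive1n] is total. *)
Definition AC_n {R : realType} (n : nat) (f : R -> R) : Prop :=
  (forall k : nat, (k < n.-1)%N -> forall x : R, derivable (derive1n k f) x 1) /\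
  (forall a b : R, a <= b -> abs_continuous_on a b (derive1n n.-1 f)).

(* For [f] in [AC_n n], [derive1n n f] is the genuine n-th derivative almost
   everywhere, and its values elsewhere do not affect the integral. *)
Definition caputo {R : realType} (n : nat) (alpha : R) (f : R -> R) : R -> R :=
  frac_integral (n%:R - alpha) (derive1n n f).

(* Functions on [0, +oo[ are represented by functions on the whole line whose
   values at negative arguments are irrelevant. *)
Definition C0_half_line {R : realType} (h : R -> R) : Prop :=
  [/\ {within `[0%R, +oo[, continuous h},
      exists M : R, forall t : R, 0 <= t -> `|h t| <= M &
      `|h t| @[t --> +oo] --> (0 : R)].

(* A notion for continuous functions only. For [f] in [AC_n n] the function
   [caputo n alpha f] need not be continuous on [0, +oo[: [derive1n n f] is only
   locally integrable, and convolving it with a singular kernel may give a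
   function that is unbounded on a bounded interval. *)
Definition asymptotically_periodic {R : realType} (T : R) (phi : R -> R) :
    Prop :=
  {within `[0%R, +oo[, continuous phi} /\
  exists f1 f2 : R -> R,
    [/\ continuous f1, periodic f1 T, C0_half_line f2 &
        forall t : R, 0 <= t -> phi t = f1 t + f2 t].

(* Main.v *)
From HB Require Import structures.
From mathcomp Require Import finmap ring lra measurable_realfun.
Require Import Defs.

(** Write [F] for the derivative of order [n - 1] of [f], [g = F'] (defined
    almost everywhere) and [b = n - alpha], so that [0 < b <= 1] and the Caputo
    derivative at [t] is, up to a constant factor, the convolution
    [J t] of the kernel [k x = x ^ (b - 1)] with [g] over [[0, t]].

    The function [F] is [T]-periodic, hence so is [g], and [g] has mean zero over
    a period because [F T = F 0].  Splitting [J (t + T)] at [s = T] and using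
    periodicity, [J (t + T) - J t] is the integral over [[0, T]] of
    [k (t + T - s) * g s].  As [g] has mean zero, [k (t + T)] may be subtracted
    from the kernel, and monotonicity of [k] gives
    [|J (t + T) - J t| <= C * (k t - k (t + T))], where [C] is the integral of
    [|g|] over a period ([kernel_convolution_increment]).  These bounds telescope,
    so [J (t + m T)] converges as [m] grows, to a periodic function which [J]
    approaches at infinity ([asymptotically_periodic_increment]); continuity of
    the limit comes from that of the Caputo derivative on the half-line, and the
    remainder is bounded because it is continuous and tends to 0.

    The substantial ingredient is that the integral of [g] over [[a, b]] is
    [F b - F a], the fundamental theorem of calculus for absolutely continuous
    functions.  It is obtained here through measures.  The total variation [V] of
    [F] is again absolutely continuous ([abs_continuous_variation]), so [F] is
    the difference of the nondecreasing absolutely continuous functions [V] and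
    [V - F].  The Stieltjes measure of such a function is dominated by Lebesgue
    measure ([uniformly_abs_continuous_null]), so by Radon-Nikodym it has a
    density; thus [F] is an indefinite integral ([abs_continuous_FTC]), and the
    Lebesgue differentiation theorem identifies the integrand with [F'] almost
    everywhere ([abs_continuous_ae_derive]).

    Since [derive1 F] is meaningless where [F] is not derivable, it is
    replaced under integrals by the measurable, exactly periodic function
    [upper_derivative F]; this changes no integral
    ([eq_integral_off_null]). *)

Set Implicit Arguments.
Unset Strict Implicit.
Unset Printing Implicit Defensive.

Local Open Scope classical_set_scope.
Local Open Scope ring_scope.

(** * Absolutely continuous functions and their variation *)

Section absolute_continuity.
Context {R : realType}.
Implicit Types (a b e d : R) (f : R -> R).

(** Degenerate intervals contribute nothing to either sum, so they can be
    dropped and the others renumbered.  An arbitrary finite index type is what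
    makes it possible to refine a family of intervals by partitions, or to
    index it by the components of a set. *)
Lemma abs_continuous_finType a b f e : abs_continuous_on a b f -> 0 < e ->
  exists2 d : R, 0 < d & forall (I : finType) (u v : I -> R),
    (forall i, [/\ a <= u i, u i <= v i & v i <= b]) ->
    trivIset setT (fun i => [set` `]u i, v i[]) ->
    \sum_i (v i - u i) < d -> \sum_i `|f (v i) - f (u i)| < e.
Proof.
move=> fAC e0; have [d d0 fd] := fAC e e0; exists d => // I u v uv tI sd.
pose A := [pred i | u i < v i].
have nA i : ~~ A i -> u i = v i.
  rewrite /= -leNgt => vu; apply/le_anti/andP; split => //.
  by have [] := uv i.
have sumA (F : I -> R) : (forall i, u i = v i -> F i = 0) ->
    \sum_i F i = \sum_(k < #|A|) F (enum_val k).
  move=> F0; rewrite (bigID A)/= [X in _ + X]big1 ?addr0; last first.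
    by move=> i /nA/F0.
  by rewrite -big_enum_val.
rewrite (sumA (fun i => `|f (v i) - f (u i)|)); last first.
  by move=> i ->; rewrite subrr normr0.
apply: (fd _ (fun k => u (enum_val k)) (fun k => v (enum_val k))).
- by move=> k; have [? _ ?] := uv (enum_val k); split => //; exact: (enum_valP k).
- move=> k l _ _ kl; apply: enum_val_inj; exact: tI.
- by rewrite -(sumA (fun i => v i - u i))// => i ->; rewrite subrr.
Qed.

Lemma abs_continuous_continuous (F : R -> R) :
  (forall a b, a <= b -> abs_continuous_on a b F) -> continuous F.
Proof.
move=> FAC x; apply/cvgrPdist_le => e e0.
have xx : x - 1 <= x + 1 by lra.
have [d d0 Fd] := abs_continuous_finType (FAC _ _ xx) e0.
near=> y.
have yx1 : `|x - y| < 1 by near: y; exact: cvgr_dist_lt.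
have yxd : `|x - y| < d by near: y; exact: cvgr_dist_lt.
have one u v : x - 1 <= u -> u <= v -> v <= x + 1 -> v - u < d -> `|F v - F u| <= e.
  move=> xu uv vx uvd; apply: ltW.
  (* a single interval, indexed by unit *)
  have := Fd unit (fun=> u) (fun=> v).
  by rewrite !big_const !card_unit/= !addr0; apply => // -[] [].
move: yx1 yxd; rewrite !ltr_norml => /andP[? ?] /andP[? ?].
by have [xy|/ltW yx] := leP x y; [rewrite distrC|]; apply: one; lra.
Unshelve. all: by end_near. Qed.

Lemma itv_partition_nth_le a b s k l : itv_partition a b s ->
  (k <= l)%N -> (l <= size s)%N -> nth b (a :: s) k <= nth b (a :: s) l.
Proof.
move=> [sa _] kl ls; have /= := @sorted_leq_nth _ <=%R le_trans lexx b (a :: s).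
apply => //; rewrite ?inE/= ?ltnS //; last exact: leq_trans ls.
by apply: sub_path sa => x y; exact: ltW.
Qed.

Lemma itv_partition_nth_size a b s : itv_partition a b s ->
  nth b (a :: s) (size s) = b.
Proof. by move=> [_ /eqP]; rewrite -[X in nth _ _ X]/((size (a :: s)).-1) nth_last. Qed.

(** The total variation over each interval is a supremum over partitions, and
    partitioning every interval of a family gives a larger family with the same
    total length, to which the same [d] applies.  The variations are finite
    because the bound already holds when one interval at a time is refined. *)
Lemma abs_continuous_total_variation a b f e :
  abs_continuous_on a b f -> 0 < e ->
  exists2 d : R, 0 < d & forall (I : finType) (u v : I -> R),
    (forall i, [/\ a <= u i, u i <= v i & v i <= b]) ->
    trivIset setT (fun i => [set` `]u i, v i[]) ->
    \sum_i (v i - u i) < d ->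
    (\sum_i total_variation (u i) (v i) f <= e%:E)%E.
Proof.
move=> fAC e0; have [d d0 fd] := abs_continuous_finType fAC e0.
exists d => // I u v uv tI sd.
have sumV (s : I -> seq R) : (forall i, itv_partition (u i) (v i) (s i)) ->
    \sum_i variation (u i) (v i) f (s i) < e.
  move=> us.
  (* all the subintervals of all the partitions *)
  pose J := {i : I & 'I_(size (s i))}.
  pose p i k := nth (v i) (u i :: s i) k.
  have pm i k l : (k <= l)%N -> (l <= size (s i))%N -> p i k <= p i l.
    by apply: itv_partition_nth_le; exact: us.
  pose u' (j : J) := p (tag j) (tagged j).
  pose v' (j : J) := p (tag j) (tagged j).+1.
  have -> : \sum_i variation (u i) (v i) f (s i) = \sum_j `|f (v' j) - f (u' j)|.
    under eq_bigr do rewrite /variation big_mkord.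
    exact: (sig_big_dep xpredT (fun _ => xpredT)
      (fun i (k : 'I_(size (s i))) => `|f (p i k.+1) - f (p i k)|)).
  have uu' j : u (tag j) <= u' j.
    by rewrite -[u _]/(p (tag j) 0%N); apply: pm => //; exact/ltnW.
  have vv' j : v' j <= v (tag j).
    rewrite -(itv_partition_nth_size (us (tag j))); exact: pm.
  apply: fd.
  - move=> j; have [au _ vb] := uv (tag j); split.
    + exact: le_trans (uu' j).
    + by apply: pm.
    + exact: le_trans (vv' j) _.
  - move=> [i k] [j l] _ _ [z [/=]]; rewrite !in_itv/= => /andP[z1 z2] /andP[z3 z4].
    have ij : i = j.
      apply: tI => //; exists z; split => /=; rewrite in_itv/=.
        by rewrite (le_lt_trans (uu' _) z1) (lt_le_trans z2 (vv' _)).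
      by rewrite (le_lt_trans (uu' _) z3) (lt_le_trans z4 (vv' _)).
    case: _ / ij in l z3 z4 *; congr existT; apply/val_inj => /=.
    move: z1 z2 z3 z4; rewrite /u' /v' /= => z1 z2 z3 z4.
    case: (ltngtP (k : nat) l) => // kl.
    + by have := lt_trans z3 z2; rewrite ltNge pm// ltnW.
    + by have := lt_trans z1 z4; rewrite ltNge pm// ltnW.
  - rewrite (le_lt_trans _ sd)// le_eqVlt; apply/orP; left; apply/eqP.
    rewrite -(sig_big_dep xpredT (fun _ => xpredT)
      (fun i (k : 'I_(size (s i))) => p i k.+1 - p i k))/=.
    apply: eq_bigr => i _.
    rewrite -(big_mkord xpredT (fun k => p i k.+1 - p i k)) telescope_sumr//.
    by rewrite /p (itv_partition_nth_size (us i)).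
have part i : exists s, itv_partition (u i) (v i) s.
  have [_ + _] := uv i; rewrite le_eqVlt => /predU1P[->|uvi].
    by exists [::]; split.
  by exists [:: v i]; exact: itv_partition1.
have [s0 s0P] := choice part.
have fin i : total_variation (u i) (v i) f \is a fin_num.
  have [_ uvi _] := uv i.
  rewrite ge0_fin_numE ?total_variation_ge0//.
  apply: (@le_lt_trans _ _ e%:E); last exact: ltry.
  apply: ge_ereal_sup => _ [_ [s sp <-] <-]; rewrite lee_fin ltW//.
  pose s' j := if j == i then s else s0 j.
  apply: le_lt_trans (sumV s' _); last first.
    by move=> j; rewrite /s'; case: eqP => [->|].
  rewrite (bigD1 i)//= {1}/s' eqxx lerDl sumr_ge0// => j _; exact: variation_ge0.
apply/lee_addgt0Pr => r r0.
have [I0|I0] := posnP #|I|.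
  rewrite big1; first by rewrite -EFinD lee_fin addr_ge0// ltW.
  by move=> i; move/card0_eq: I0 => /(_ i); rewrite inE.
(* each supremum is approached within r / #|I|, to make the total error r *)
have near i : exists s, itv_partition (u i) (v i) s /\
    (total_variation (u i) (v i) f <= (variation (u i) (v i) f s + r / #|I|%:R)%:E)%E.
  have rI : 0 < r / #|I|%:R by rewrite divr_gt0// ltr0n.
  have [_ [_ [s sp <-] <-] /= ] := ub_ereal_sup_adherent rI (fin i).
  move=> h; exists s; split => //; apply/ltW.
  by rewrite EFinD -lteBlDr.
have [s sP] := choice near.
apply: (@le_trans _ _ (\sum_i (variation (u i) (v i) f (s i) + r / #|I|%:R)%:E)%E).
  by apply: lee_sum => i _; have [] := sP i.
rewrite sumEFin lee_fin big_split/= sumr_const lerD//.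
  by apply/ltW/sumV => i; have [] := sP i.
rewrite -[X in X <= _]mulr_natr divfK// pnatr_eq0 -lt0n//.
Qed.

(** The same modulus serves on the whole line, and the conclusion is a weak
    inequality because it is inherited by suprema. *)
Definition uniformly_abs_continuous (G : R -> R) := forall e, 0 < e ->
  exists2 d : R, 0 < d & forall (I : finType) (u v : I -> R),
    (forall i, u i <= v i) ->
    trivIset setT (fun i => [set` `]u i, v i[]) ->
    \sum_i (v i - u i) < d -> \sum_i `|G (v i) - G (u i)| <= e.

Definition clamp a b (x : R) : R := Num.max a (Num.min x b).

Lemma clamp_itv a b x : a <= b -> a <= clamp a b x <= b.
Proof. by move=> ab; rewrite /clamp le_max lexx/= ge_max ab/= ge_min lexx orbT. Qed.

Lemma clamp_nondecreasing a b : {homo clamp a b : x y / x <= y}.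
Proof.
move=> x y xy; rewrite /clamp ge_max !le_max lexx/=; apply/orP; right.
by rewrite le_min !ge_min xy lexx orbT.
Qed.

Lemma clampK a b x : a <= x -> x <= b -> clamp a b x = x.
Proof. by move=> ax xb; rewrite /clamp (min_idPl xb) (max_idPr ax). Qed.

Lemma clamp_contract a b u v : a <= b -> u <= v -> clamp a b v - clamp a b u <= v - u.
Proof.
move=> ab uv; rewrite /clamp.
case: (leP u b) => ub; case: (leP v b) => vb; rewrite /Num.max;
  do ?case: ifP => ?; lra.
Qed.

Lemma clamp_subset_itv a b u v : a <= b ->
  [set` `]clamp a b u, clamp a b v[] `<=` [set` `]u, v[].
Proof.
move=> ab z /=; rewrite !in_itv/= /clamp.
rewrite lt_max gt_max gt_min lt_min => /andP[/andP[az uzb] /orP[za|/andP[zv zb]]].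
  by have := lt_trans az za; rewrite ltxx.
by rewrite zv andbT; case/orP: uzb => // /(lt_trans zb); rewrite ltxx.
Qed.

(** Jordan decomposition: [V] is the total variation from [a], made constant
    outside [[a, b]].  The last clause makes [V - f \o clamp a b] nondecreasing as
    well, so that on [[a, b]] [f] is a difference of two nondecreasing functions that are still
    absolutely continuous. *)
Lemma abs_continuous_variation a b f : a <= b -> abs_continuous_on a b f ->
  exists V : R -> R, [/\ {homo V : x y / x <= y}, uniformly_abs_continuous V &
    forall u v, u <= v ->
      `|f (clamp a b v) - f (clamp a b u)| <= V v - V u].
Proof.
move=> ab fAC; set c := clamp a b.
have ac x : a <= c x by case/andP: (clamp_itv x ab).
have cb x : c x <= b by case/andP: (clamp_itv x ab).
have c_nd : {homo c : x y / x <= y} by exact: clamp_nondecreasing.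
have [d1 d10 fd1] := abs_continuous_total_variation fAC ltr01.
have small u v : a <= u -> u <= v -> v <= b -> v - u < d1 ->
    (total_variation u v f <= 1)%E.
  move=> au uv vb uvd.
  have := fd1 unit (fun=> u) (fun=> v).
  rewrite !big_const !card_unit/= addr0 adde0; apply => //.
  by move=> [] [].
(* variation is additive and at most 1 on each step of length d1 / 2 *)
have fin n : forall v, a <= v -> v <= b -> v - a < (d1 / 2) *+ n ->
    total_variation a v f \is a fin_num.
  elim: n => [v av _|n ih v av vb].
    by rewrite mulr0n subr_lt0 ltNge av.
  move=> h; pose w := Num.max a (v - d1 / 2).
  have aw : a <= w by rewrite /w le_max lexx.
  have wv : w <= v by rewrite /w ge_max av/= gerBl; lra.
  rewrite (total_variationD f aw wv) fin_numD; apply/andP; split.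
    have [->|/eqP wa] := eqVneq w a; first by rewrite total_variationxx.
    apply: ih => //; first exact: le_trans vb.
    rewrite mulrS in h; move: wa; rewrite /w /Num.max; case: ifP => // _ _; lra.
  rewrite ge0_fin_numE ?total_variation_ge0//.
  apply: (@le_lt_trans _ _ 1%E); last exact: ltry.
  by apply: small => //; rewrite /w /Num.max; case: ifP; lra.
have {}fin v : a <= v -> v <= b -> total_variation a v f \is a fin_num.
  move=> av vb; apply: (fin (Num.bound ((v - a) / (d1 / 2)))) => //.
  rewrite -mulr_natr mulrC -ltr_pdivrMr; last lra.
  by apply: archi_boundP; rewrite divr_ge0//; lra.
pose V x := fine (total_variation a (c x) f).
have VB u v : u <= v -> (V v - V u)%:E = total_variation (c u) (c v) f.
  move=> uv; rewrite EFinB !fineK ?fin//.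
  rewrite (total_variationD f (ac u) (c_nd _ _ uv)) addeAC subee ?fin// add0e//.
have Vdist u v : u <= v -> `|f (c v) - f (c u)| <= V v - V u.
  by move=> uv; rewrite -lee_fin VB// total_variation_ge// c_nd.
have V_nd : {homo V : x y / x <= y}.
  by move=> u v uv; rewrite -subr_ge0 (le_trans _ (Vdist _ _ uv)).
exists V; split => // e e0.
have [d d0 fd] := abs_continuous_total_variation fAC e0.
exists d => // I u v uv tI sd.
rewrite -lee_fin; apply: (le_trans _ (fd I (c \o u) (c \o v) _ _ _)) => /=.
- rewrite -sumEFin; apply: lee_sum => i _.
  by rewrite ger0_norm ?VB// subr_ge0 V_nd.
- by move=> i; split => //; exact: c_nd.
- move=> i j _ _ [z [zi zj]]; apply: tI => //; exists z.
  by split; exact: (clamp_subset_itv ab).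
- apply: le_lt_trans sd; apply: ler_sum => i _; exact: clamp_contract.
Qed.

End absolute_continuity.

(** * Stieltjes measures of absolutely continuous functions *)

Section stieltjes.
Context {R : realType}.
Notation mu := (@lebesgue_measure R).

Lemma lebesgue_stieltjes_measure_itv_oc (G : cumulative R R) (x y : R) : x <= y ->
  lebesgue_stieltjes_measure G `]x, y] = (G y - G x)%:E.
Proof.
move=> xy; rewrite /lebesgue_stieltjes_measure /measure_extension.
rewrite measurable_mu_extE/=; last exact: is_ocitv.
exact: wlength_itv_bnd.
Qed.

(** A finite union of half-open intervals is a disjoint one; the decomposition
    does not depend on the measure, which allows Lebesgue and Stieltjes measures
    of the same set to be compared. *)
Lemma ring_itv_oc (A : set (SetRing.type (ocitv_type R))) : measurable A ->
  exists (I : finType) (u v : I -> R), [/\ forall i, u i <= v i,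
    trivIset setT (fun i => [set` `]u i, v i]]) &
    forall G : cumulative R R,
      lebesgue_stieltjes_measure G A = (\sum_i (G (v i) - G (u i)))%:E].
Proof.
move=> mA; have [B [finB B0 tB mB AB]] := @SetRing.ring_finite_set _ _ A mA.
have ocB X : exists p : R * R, B X -> p.1 < p.2 /\ X = `]p.1, p.2]%classic.
  have [BX|nBX] := pselect (B X); last by exists (0, 0).
  have /= := mB X (mem_set BX).
  move=> /ocitvP[X0|[p p12 ->]]; last by exists p.
  by have [x] := B0 X BX; rewrite X0.
have [p pP] := choice ocB.
have BP (X : fset_set B) : B (val X).
  by have := valP X; rewrite in_fset_set// => /set_mem.
exists (fset_set B : finType), (fun X => (p (val X)).1), (fun X => (p (val X)).2).
split.
- by move=> X; have [/ltW] := pP _ (BP X).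
- move=> X Y _ _; rewrite -(pP _ (BP X)).2 -(pP _ (BP Y)).2 => XY.
  by apply/val_inj; apply: tB; [exact: BP|exact: BP|exact: XY].
move=> G; rewrite AB measure_fin_bigcup//=; last first.
  by move=> X BX; apply: sub_sigma_algebra; exact/mB/mem_set.
rewrite fsbig_finite//= big_seq_fsetE/= -sumEFin.
apply: eq_bigr => X _; have [pX {1}->] := pP _ (BP X).
by rewrite lebesgue_stieltjes_measure_itv_oc ?(ltW pX).
Qed.

Lemma uniformly_abs_continuous_cumulative (G : R -> R) :
  {homo G : x y / x <= y} -> uniformly_abs_continuous G ->
  exists H : cumulative R R, H = G :> (R -> R).
Proof.
move=> ndG acG; suff rcG : right_continuous G.
  pose H := isCumulative.Build _ _ _ G ndG rcG.
  by exists (HB.pack_for (cumulative R R) G H).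
move=> x; apply/cvgrPdist_le => e e0; have [d d0 Gd] := acG _ e0.
near=> y.
have xy : x <= y by near: y; exact: nbhs_right_ge.
have := Gd unit (fun=> x) (fun=> y).
rewrite !big_const !card_unit/= !addr0 distrC; apply => //.
- by move=> [] [].
- by rewrite ltrBlDl; near: y; apply: nbhs_right_lt; rewrite ltrDl.
Unshelve. all: by end_near. Qed.

(** A Lebesgue-null set is covered by half-open intervals of total length less
    than [d].  Finite unions of them are disjoint unions of intervals of total
    length less than [d], so their Stieltjes measure is at most [e], and this
    passes to the increasing limit. *)
Lemma uniformly_abs_continuous_null (G : cumulative R R) :
  uniformly_abs_continuous G -> lebesgue_stieltjes_measure G `<< mu.
Proof.
move=> acG; apply/null_content_dominatesP => A mA muA.
apply/eqP; rewrite -measure_le0; apply/lee_addgt0Pr => e e0; rewrite add0e.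
have [d d0 Gd] := acG e e0.
have /ereal_inf_lt [_ [F [mF AF] <-] Fd] : (mu A < d%:E)%E by rewrite muA lte_fin.
pose U n : set (measurableTypeR R) := \big[setU/set0]_(i < n.+1) F i.
have mFR i : measurable (F i : set (measurableTypeR R)).
  by apply: sub_sigma_algebra; exact: mF.
have mU n : measurable (U n) by apply: bigsetU_measurable => i _.
have UF : \bigcup_n U n = \bigcup_n F n by rewrite bigcup_bigsetU_bigcup.
have Ud n : (mu (U n) < d%:E)%E.
  apply: le_lt_trans Fd.
  apply: le_trans (_ : (\sum_(i < n.+1) mu (F i) <= _)%E).
    exact: (@Boole_inequality _ _ (measurableTypeR R) mu F n.+1 (fun i _ => mFR i)).
  rewrite (eq_bigr (fun i : 'I_n.+1 => wlength idfun (F i))); last first.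
    move=> i _; rewrite /mu /lebesgue_stieltjes_measure /measure_extension/=.
    by rewrite measurable_mu_extE.
  rewrite -(big_mkord xpredT (fun i => wlength idfun (F i))).
  exact: nneseries_lim_ge.
have Ue n : (lebesgue_stieltjes_measure G (U n) <= e%:E)%E.
  have [|I [u [v [uv tI UE]]]] := @ring_itv_oc (U n).
    by apply: bigsetU_measurable => i _; apply: sub_gen_smallest; exact: mF.
  rewrite UE lee_fin; apply: le_trans (ler_sum _ _) (Gd I u v uv _ _) => //.
  - by move=> i _; exact: ler_norm.
  - move=> i j _ _ [z [zi zj]]; apply: tI => //; exists z.
    by split; [move: zi|move: zj] => /=; rewrite !in_itv/= => /andP[-> /ltW].
  - by have := Ud n; rewrite [mu _](UE idfun) lte_fin.
have mUU : measurable (\bigcup_n U n) by exact: bigcupT_measurable.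
apply: (@le_trans _ _ (lebesgue_stieltjes_measure G (\bigcup_n U n))).
  by apply: le_measure; rewrite ?inE// UF.
have cvgU := @nondecreasing_cvg_mu _ _ _ (lebesgue_stieltjes_measure G) U mU mUU.
rewrite -(cvg_lim _ (cvgU _))//; last first.
  by move=> m n mn; apply/subsetPset; exact: subset_bigsetU.
apply: lime_le; last by apply: nearW.
apply/cvg_ex; eexists; apply: cvgU.
by move=> m n mn; apply/subsetPset; exact: subset_bigsetU.
Qed.

(** The Radon-Nikodym derivative of the Stieltjes measure of [G].  The measure
    is restricted to a bounded interval to make it finite. *)
Lemma uniformly_abs_continuous_density (a b : R) (G : R -> R) : a <= b ->
  {homo G : x y / x <= y} -> uniformly_abs_continuous G ->
  exists2 h : R -> R, mu.-integrable setT (EFin \o h) &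
    forall x, a <= x -> x <= b -> G x - G a = (\int[mu]_(t in `[a, x]) h t)%R.
Proof.
move=> ab ndG acG; have [H HG] := uniformly_abs_continuous_cumulative ndG acG.
rewrite -{}HG in ndG acG *.
pose D : set (measurableTypeR R) := `]a, b]%classic.
have mD : measurable D by exact: measurable_itv.
have Doo : (lebesgue_stieltjes_measure H D < +oo)%E.
  by rewrite lebesgue_stieltjes_measure_itv_oc// ltry.
pose nu : {finite_measure set (measurableTypeR R) -> \bar R} := mfrestr mD Doo.
have [|f [f0 ffin fint fE]] := @radon_nikodym_sigma_finite _ _ _ mu nu.
  apply/null_content_dominatesP => A mA muA.
  rewrite /nu/= /mfrestr /mrestr.
  have /null_content_dominatesP/(_ A mA muA) HA := uniformly_abs_continuous_null acG.
  by apply: (subset_measure0 _ mA _ HA); [exact: measurableI|exact: subIsetl].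
have fK : EFin \o (fine \o f) = f by apply/funext => x /=; rewrite fineK.
exists (fine \o f); first by rewrite fK.
move=> x ax xb; rewrite /Rintegral.
under eq_integral do rewrite fineK//.
rewrite -integral_itv_obnd_cbnd; last first.
  by apply: measurable_funS (measurable_int _ fint).
rewrite -fE//= /mfrestr /mrestr setIidl ?lebesgue_stieltjes_measure_itv_oc//.
by apply: subset_itvl; rewrite bnd_simp.
Qed.

End stieltjes.

(** * The fundamental theorem of calculus *)

Section ftc.
Context {R : realType}.
Notation mu := (@lebesgue_measure R).
Implicit Types (a b : R) (f : R -> R).

(** Take the densities of the two terms of [f = V - (V - f)]. *)
Lemma abs_continuous_FTC a b f : a <= b -> abs_continuous_on a b f ->
  exists2 h : R -> R, mu.-integrable setT (EFin \o h) &
    forall x, a <= x -> x <= b -> f x - f a = \int[mu]_(t in `[a, x]) h t.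
Proof.
move=> ab fAC; have [V [ndV acV Vf]] := abs_continuous_variation ab fAC.
pose W x := V x - f (clamp a b x).
have WV u v : u <= v -> 0 <= W v - W u <= 2 * (V v - V u).
  by move=> /Vf; rewrite /W ler_norml => /andP[? ?]; apply/andP; split; lra.
have ndW : {homo W : x y / x <= y}.
  by move=> u v uv; have /andP[] := WV _ _ uv; rewrite subr_ge0.
have acW : uniformly_abs_continuous W.
  move=> e e0; have e20 : 0 < e / 2 by rewrite divr_gt0.
  have [d d0 Vd] := acV _ e20; exists d => // I u v uv tI sd.
  apply: (@le_trans _ _ (2 * \sum_i `|V (v i) - V (u i)|)).
    rewrite mulr_sumr; apply: ler_sum => i _.
    rewrite ger0_norm; last by case/andP: (WV _ _ (uv i)).
    have /andP[_ h] := WV _ _ (uv i).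
    by apply: le_trans h _; rewrite ler_wpM2l// ler_norm.
  by rewrite -ler_pdivlMl// mulrC Vd.
have [h1 ih1 h1E] := uniformly_abs_continuous_density ab ndV acV.
have [h2 ih2 h2E] := uniformly_abs_continuous_density ab ndW acW.
exists (h1 \- h2).
  rewrite (_ : _ \o _ = (EFin \o h1) \- (EFin \o h2))%E; first exact: integrableB.
  by apply/funext => x /=; rewrite EFinB.
move=> x ax xb; rewrite RintegralB//; last 2 first.
  exact: integrableS ih1.
  exact: integrableS ih2.
rewrite -h1E// -h2E// /W !clampK//; ring.
Qed.

(** Lebesgue differentiation applies to the indefinite integral of [h], with
    which [f] agrees near each interior point up to a constant. *)
Lemma abs_continuous_ae_derive a b f (h : R -> R) : a <= b ->
  mu.-integrable setT (EFin \o h) ->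
  (forall x, a <= x -> x <= b -> f x - f a = \int[mu]_(t in `[a, x]) h t) ->
  {ae mu, forall x, a < x < b -> derivable f x 1 /\ derive1 f x = h x}.
Proof.
move=> ab ih fh.
have ihy y : mu.-integrable [set` Interval (BLeft a) (BRight y)] (EFin \o h).
  exact: integrableS ih.
have loc : locally_integrable [set: R] h.
  by apply: open_integrable_locally => //; exact: openT.
have := FTC1 ihy loc; apply: filterS; first exact: (ae_filter_ringOfSetsType mu).
move=> x /= Fx /andP[ax xb].
have {Fx} [|dF F'] := Fx; first by rewrite /= lte_fin.
have nearE : {near x, (fun y => \int[mu]_(t in `[a, y]) h t + f a) =1 f}.
  have : x \in `]a, b[ by rewrite in_itv/= ax.
  move=> /near_in_itvoo; apply: filterS => y.
  by rewrite in_itv/= => /andP[ay yb]; rewrite -fh ?ltW// subrK.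
set F := fun y => _ + f a in nearE.
have isF : is_derive x 1 F (h x + 0).
  apply: is_deriveD; rewrite -F' derive1E; exact: derivableP.
rewrite addr0 in isF.
have isf : is_derive x 1 f (h x) by apply: near_eq_is_derive isF; rewrite ?oner_neq0.
by split; [exact: ex_derive|rewrite derive1E derive_val].
Qed.

(** The exceptional set is named, and the endpoints are put into it, so that
    integrals over [[a, b]] can be compared outside it even for integrands that
    are not known to be measurable. *)
Lemma abs_continuous_derive1_off_null a b (F : R -> R) : a <= b ->
  abs_continuous_on a b F ->
  exists (h : R -> R) (N : set (measurableTypeR R)), [/\ mu.-integrable setT (EFin \o h),
    \int[mu]_(t in `[a, b]) h t = F b - F a, measurable N, mu N = 0%E &
    forall x, a <= x <= b -> ~ N x -> derivable F x 1 /\ derive1 F x = h x].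
Proof.
move=> ab FAC; have [h ih hE] := abs_continuous_FTC ab FAC.
have ae_neq c : {ae mu, forall x, x <> c}.
  exists [set c]; split => //; first exact: lebesgue_measure_set1.
  by move=> x /= /contrapT.
have [N [mN N0 FN]] : {ae mu, forall x, a <= x <= b ->
    derivable F x 1 /\ derive1 F x = h x}.
  move: (ae_neq b) (ae_neq a) (abs_continuous_ae_derive ab ih hE).
  apply: filterS3.
  move=> x /= /eqP xb /eqP xa Fx /andP[ax xb'].
  by apply: Fx; rewrite !lt_neqAle ax xb' xb eq_sym xa.
exists h, N; split => //; first by rewrite hE.
by move=> x xab Nx; apply: contra_notP Nx => nF; apply: FN => /(_ xab).
Qed.

End ftc.

(** * A measurable version of the derivative *)

Section null_sets.
Context d (T : measurableType d) (R : realType) (mu : {measure set T -> \bar R}).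
Import HBNNSimple.

(** The integral of any nonnegative function, measurable or not, is the supremum
    of the integrals of the simple functions below it, and a simple function can
    be set to zero on [N] without changing its integral.  Since [derive1] of an
    absolutely continuous function is known only almost everywhere, it is under
    integrals of this generality that it has to be replaced. *)
Lemma eq_integral_off_null (D N : set T) (f g : T -> \bar R) :
  measurable N -> mu N = 0%E -> (forall x, D x -> ~ N x -> f x = g x) ->
  (\int[mu]_(x in D) f x = \int[mu]_(x in D) g x)%E.
Proof.
move=> mN N0; move: f g.
suff pos (f g : T -> \bar R) : (forall x, 0 <= f x)%E -> (forall x, 0 <= g x)%E ->
    (forall x, ~ N x -> f x = g x) -> (\int[mu]_x f x <= \int[mu]_x g x)%E.
  have pos_eq (f g : T -> \bar R) : (forall x, 0 <= f x)%E -> (forall x, 0 <= g x)%E ->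
    (forall x, ~ N x -> f x = g x) -> (\int[mu]_x f x = \int[mu]_x g x)%E.
    by move=> f0 g0 fg; apply/eqP; rewrite eq_le !pos// => x /fg.
  move=> f g fg; rewrite !(integral_mkcond D) integralE [RHS]integralE.
  have fgD x : ~ N x -> (f \_ D) x = (g \_ D) x.
    by move=> Nx; rewrite !patchE; case: ifPn => // /set_mem Dx; rewrite fg.
  congr (_ - _)%E; apply: pos_eq => // x /fgD fgx.
    by rewrite funepos.unlock fgx.
  by rewrite funeneg.unlock fgx.
move=> f0 g0 fg; rewrite !ge0_integralTE//.
apply: ge_ereal_sup => _ [s sf <-]; apply: ereal_sup_ubound.
have mNC := measurableC mN.
exists (proj_nnsfun s mNC) => /=.
  move=> x; rewrite /= mindicE.
  have [Nx|_] := boolP (x \in ~` N); last by rewrite mulr0.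
  by rewrite mulr1 -fg; [exact: sf|exact: set_mem].
rewrite -!integralT_nnsfun; apply: ae_eq_integral => //.
- exact/measurable_EFinP.
- exact/measurable_EFinP.
- exists N; split => // x /= /not_implyP[_]; apply: contra_notP => Nx.
  by rewrite mindicE mem_set ?mulr1.
Qed.

End null_sets.

Section upper_derivative.
Context {R : realType}.
Notation mu := (@lebesgue_measure R).

(** A limsup of difference quotients along steps [1 / n.+1].  It is measurable
    whenever [F] is continuous, inherits periods exactly and not only almost
    everywhere, and is the derivative wherever there is one; so it can stand for
    [derive1 F] under an integral. *)
Definition upper_derivative (F : R -> R) (x : R) : R :=
  fine (limn_esup (fun n => ((F (x + n.+1%:R^-1) - F x) * n.+1%:R)%:E)).

Lemma measurable_upper_derivative (F : R -> R) : continuous F ->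
  measurable_fun [set: R] (upper_derivative F).
Proof.
move=> cF; apply: measurableT_comp => //.
apply: measurable_fun_limn_esup => n; apply/measurable_EFinP.
apply: continuous_measurable_fun => x; apply: cvgM; last exact: cvg_cst.
apply: cvgB; last exact: cF.
apply: (@continuous_comp _ _ _ (fun y : R => y + n.+1%:R^-1) F); last exact: cF.
by apply: cvgD; [exact: cvg_id|exact: cvg_cst].
Qed.

Lemma periodic_upper_derivative (F : R -> R) (T : R) : periodic F T ->
  periodic (upper_derivative F) T.
Proof.
move=> FT x; rewrite /upper_derivative; congr (fine (limn_esup _)).
by apply/funext => n; rewrite addrAC !FT.
Qed.

Lemma derivable_upper_derivative (F : R -> R) (x : R) : derivable F x 1 ->
  upper_derivative F x = derive1 F x.
Proof.
move=> dF; rewrite /upper_derivative.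
have cv : (fun n => ((F (x + n.+1%:R^-1) - F x) * n.+1%:R)) @ \oo --> derive1 F x.
  have un0 n : n.+1%:R^-1 != 0 :> R by rewrite invr_eq0 pnatr_eq0.
  have /(cvgr_dnbhsP _ _ _).1 dFx :
      (fun h : R => h^-1 *: ((F \o shift x) (h *: 1) - F x)) @ 0^' -->
      derive1 F x.
    by rewrite derive1E; exact: dF.
  have {dFx} /= := dFx (fun n => n.+1%:R^-1) (conj un0 cvg_harmonic).
  apply: cvg_trans; apply: near_eq_cvg; apply: nearW => n /=.
  by rewrite invrK /GRing.scale/= mulr1 mulrC (addrC x).
have cvE : (fun n => ((F (x + n.+1%:R^-1) - F x) * n.+1%:R)%:E) @ \oo -->
    (derive1 F x)%:E by apply/fine_cvgP; split; [exact: nearW|exact: cv].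
rewrite is_cvg_limn_esupE; last by apply/cvg_ex; eexists; exact: cvE.
by rewrite (cvg_lim _ cvE).
Qed.

Lemma abs_continuous_upper_derivative (F : R -> R) a b : a <= b ->
  abs_continuous_on a b F -> continuous F ->
  mu.-integrable `[a, b] (EFin \o upper_derivative F) /\
  \int[mu]_(t in `[a, b]) upper_derivative F t = F b - F a.
Proof.
move=> ab FAC cF.
have [h [N [ih hE mN N0 FN]]] := abs_continuous_derive1_off_null ab FAC.
have gh x : `[a, b]%classic x -> ~ N x -> upper_derivative F x = h x.
  rewrite /= in_itv/= => xab Nx; have [dF <-] := FN x xab Nx.
  exact: derivable_upper_derivative.
split.
  apply/integrableP; split.
    by apply/measurable_EFinP/measurable_funTS; exact: measurable_upper_derivative.
  have : mu.-integrable `[a, b] (EFin \o h) by exact: integrableS ih.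
  move=> /integrableP[_].
  apply: le_lt_trans; rewrite le_eqVlt; apply/orP; left; apply/eqP.
  by apply: (eq_integral_off_null mN N0) => x xab Nx /=; rewrite gh.
rewrite -hE /Rintegral; congr fine.
by apply: (eq_integral_off_null mN N0) => x xab Nx /=; rewrite gh.
Qed.

End upper_derivative.

(** * Convolution of a monotone kernel with a periodic function *)

Section translation.
Context {R : realType}.
Notation mu := (@lebesgue_measure R).

Lemma measurable_addr (c : R) : measurable_fun [set: R] (fun x : R => x + c).
Proof. exact: measurable_funD. Qed.

Lemma lebesgue_measure_translation (c : R) (A : set (measurableTypeR R)) : measurable A ->
  mu A = pushforward mu (fun x : measurableTypeR R => (x + c : measurableTypeR R)) A.
Proof.
move=> mA.
have mc : measurable_fun [set: measurableTypeR R] (fun x : measurableTypeR R =>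
  (x + c : measurableTypeR R)) := measurable_addr c.
(* the measure structure of a pushforward takes the measurability proof mc *)
pose nu : {measure set (measurableTypeR R) -> \bar R} :=
  pushforward mu (fun x : measurableTypeR R => (x + c : measurableTypeR R)).
have muE X : ocitv X -> mu X = nu mc X.
  move=> [[x y] _ <-]; rewrite /nu/= /pushforward/=.
  rewrite (_ : _ @^-1` _ = `]x - c, y - c]%classic); last first.
    by apply/seteqP; split => z /=; rewrite !in_itv/= ltrBlDr lerBrDr.
  rewrite !lebesgue_measure_itv/= !lte_fin ltrD2r -!EFinB.
  by case: ifP => // _; congr EFin; ring.
exact: (lebesgue_measure_unique muE mA).
Qed.

(** The integral is the difference of those of the positive and negative parts,
    each invariant under translation even if infinite, so this applies to the
    non-integrable products that occur in a convolution. *)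
Lemma integral_translation (a b c : R) (f : R -> \bar R) :
  measurable_fun [set: R] f ->
  (\int[mu]_(x in `[(a + c)%R, (b + c)%R]) f x =
   \int[mu]_(x in `[a, b]) f (x + c)%R)%E.
Proof.
move=> mf.
suff pos (g : R -> \bar R) : measurable_fun [set: R] g -> (forall x, 0 <= g x)%E ->
  (\int[mu]_(x in `[(a + c)%R, (b + c)%R]) g x =
   \int[mu]_(x in `[a, b]) g (x + c)%R)%E.
  rewrite integralE [RHS]integralE !pos//.
  - congr (_ - _)%E; apply: eq_integral => x _.
      by rewrite funepos.unlock.
    by rewrite funeneg.unlock.
  - exact: measurable_funeneg.
  - exact: measurable_funepos.
move=> mg g0.
have mc : measurable_fun [set: measurableTypeR R] (fun x : measurableTypeR R =>
  (x + c : measurableTypeR R)) := measurable_addr c.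
(* the measure structure of a pushforward takes the measurability proof mc *)
pose nu : {measure set (measurableTypeR R) -> \bar R} :=
  pushforward mu (fun x : measurableTypeR R => (x + c : measurableTypeR R)).
rewrite (@eq_measure_integral _ (measurableTypeR R) R _ (nu mc)); last first.
  by move=> A mA _; exact: lebesgue_measure_translation.
rewrite (ge0_integral_pushforward mc)//; last exact: measurable_funTS.
congr integral; apply/seteqP; split => z /=; by rewrite !in_itv/= !lerD2r.
Qed.

End translation.

Section kernel_convolution.
Context {R : realType}.
Notation mu := (@lebesgue_measure R).

Definition kernel_convolution (k g : R -> R) (x : R) : R :=
  \int[mu]_(s in `[0, x]) (k (x - s) * g s).

(** Split the integral over [[0, t + T]] at [T].  By periodicity, the part beyond
    [T] is the convolution at [t].  On [[0, T]] the kernel varies between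
    [k (t + T)] and [k t], and since [g] has mean zero the constant [k (t + T)]
    can be subtracted from it.
    The product [k (t - s) * g s] may fail to be integrable near [s = t]; the
    extended-real integral is then infinite at both [t] and [t + T], both
    convolutions are 0 by convention, and the bound still holds. *)
Lemma kernel_convolution_increment (k g : R -> R) (T t : R) :
  measurable_fun [set: R] k -> (forall x y, 0 < x -> x <= y -> k y <= k x) ->
  measurable_fun [set: R] g -> periodic g T ->
  mu.-integrable `[0, T] (EFin \o g) -> \int[mu]_(s in `[0, T]) g s = 0 ->
  0 < T -> 0 < t ->
  `|kernel_convolution k g (t + T) - kernel_convolution k g t| <=
     (k t - k (t + T)) * \int[mu]_(s in `[0, T]) `|g s|.
Proof.
move=> mk nik mg gT ig g0 T0 t0.
have mker x : measurable_fun [set: R] (fun s => k (x - s)).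
  by apply: measurableT_comp => //; exact: measurable_funB.
pose p s := k (t + T - s) * g s.
have mp : measurable_fun [set: R] p by exact: measurable_funM.
pose q s := (k (t + T - s) - k (t + T)) * g s.
have kq s : s \in `[0, T] -> `|k (t + T - s) - k (t + T)| <= k t - k (t + T).
  rewrite in_itv/= => /andP[s0 sT]; rewrite ger0_norm; last first.
    by rewrite subr_ge0 nik//; lra.
  by rewrite lerD2r nik//; lra.
have iq : mu.-integrable `[0, T] (EFin \o q).
  rewrite (_ : _ \o _ =
    (EFin \o (fun s => k (t + T - s) - k (t + T))%R) \* (EFin \o g))%E; last first.
    by apply/funext => s /=; rewrite EFinM.
  apply: integrableMr => //.
    by apply: measurable_funTS; apply: measurable_funB; first exact: mker.
  exists (k t - k (t + T)); split; first exact: num_real.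
  by move=> x Mx s /= sT; apply: le_trans (ltW Mx); exact: kq.
have icg : mu.-integrable `[0, T] (EFin \o (fun s => k (t + T) * g s)).
  rewrite (_ : _ \o _ = (fun s => (k (t + T))%:E * (EFin \o g) s))%E//.
  exact: integrableZl.
have pE : p = q \+ (fun s => k (t + T) * g s).
  by apply/funext => s; rewrite /p /q/=; ring.
have ip : mu.-integrable `[0, T] (EFin \o p).
  rewrite pE (_ : _ \o _ = (EFin \o q) \+ (EFin \o (fun s => k (t + T) * g s)%R))%E//.
  exact: integrableD.
have A0 : \int[mu]_(s in `[0, T]) p s = \int[mu]_(s in `[0, T]) q s.
  by rewrite pE RintegralD// RintegralZl// g0 mulr0 addr0.
have Aq : `|\int[mu]_(s in `[0, T]) p s| <=
    (k t - k (t + T)) * \int[mu]_(s in `[0, T]) `|g s|.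
  rewrite A0; apply: le_trans (le_normr_Rintegral _ iq) _ => //.
  have ing : mu.-integrable `[0, T] (EFin \o (fun s => `|g s|)) by exact: integrable_norm.
  rewrite -RintegralZl//; apply: le_Rintegral => //.
  - exact: integrable_norm.
  - rewrite (_ : _ \o _ =
      (fun s => (k t - k (t + T))%:E * (EFin \o (fun s => `|g s|)%R) s))%E//.
    exact: integrableZl.
  - by move=> s sT; rewrite normrM ler_wpM2r// kq.
have split_int : (\int[mu]_(s in `[0%R, (t + T)%R]) (p s)%:E =
    \int[mu]_(s in `[0%R, T]) (p s)%:E +
    \int[mu]_(s in `[0%R, t]) (k (t - s) * g s)%:E)%E.
  rewrite (@itv_bndbnd_setU _ _ _ (BRight T))/= ?bnd_simp; last 2 first.
  - exact: ltW.
  - by rewrite lerDr ltW.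
  rewrite integral_setU//=; last 2 first.
  - exact/measurable_EFinP/measurable_funTS.
  - apply/disj_setPS => s [/=]; rewrite !in_itv/= => /andP[_ sT] /andP[Ts _].
    by have := lt_le_trans Ts sT; rewrite ltxx.
  congr (_ + _)%E; rewrite integral_itv_obnd_cbnd; last first.
    exact/measurable_EFinP/measurable_funTS.
  rewrite -[X in `[X, _]]add0r integral_translation; last exact/measurable_EFinP.
  by apply: eq_integral => s _; rewrite /p gT; congr ((k _ * _)%:E); ring.
have Afin : (\int[mu]_(s in `[0%R, T]) (p s)%:E \is a fin_num)%E.
  exact: integrable_fin_num ip.
have -> : kernel_convolution k g (t + T) =
  fine (\int[mu]_(s in `[0%R, (t + T)%R]) (p s)%:E)%E by [].
(* finite or infinite value of the convolution at t *)
rewrite split_int; move: Aq; rewrite /kernel_convolution /Rintegral.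
move: Afin.
case: (integral mu `[0%R, T]%classic (EFin \o p)) => [A| |]//= _.
case: (integral mu `[0%R, t]%classic _) => [B| |]/=; first by rewrite addrK.
  by rewrite subrr normr0; apply: le_trans.
by rewrite subrr normr0; apply: le_trans.
Qed.

Lemma kernel_convolution_derive1 (k F : R -> R) t : 0 <= t ->
  abs_continuous_on 0 t F ->
  kernel_convolution k (derive1 F) t = kernel_convolution k (upper_derivative F) t.
Proof.
move=> t0 FAC.
have [h [N [ih hE mN N0 FN]]] := abs_continuous_derive1_off_null t0 FAC.
rewrite /kernel_convolution /Rintegral; congr fine.
apply: (eq_integral_off_null mN N0) => x xab Nx /=.
rewrite /= in_itv/= in xab; have [dF _] := FN x xab Nx.
by rewrite derivable_upper_derivative.
Qed.

End kernel_convolution.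

(** * Asymptotic periodicity from increments over a period *)

Section increments.
Context {R : realType}.

Lemma exists_ge_mulrn (T x : R) : 0 < T -> exists n, x <= T *+ n.
Proof.
move=> T0; exists (Num.bound `|x / T|); rewrite -mulr_natl -ler_pdivrMr//.
by apply: le_trans (ler_norm _) _; exact/ltW/archi_boundP.
Qed.

(** The bounds telescope to [|Phi (t + n T) - Phi t| <= w t - w (t + n T)], and
    since [w] is nonincreasing and bounded below the right-hand side is small for
    large [t], uniformly in [n].  Hence [f1 t = lim Phi (t + n T)] exists, is
    [T]-periodic, and [Phi - f1] tends to 0 at infinity.  Continuity of [f1] at
    [t] comes from that of [Phi] far to the right, at [t + n T]. *)
Lemma asymptotically_periodic_increment (T : R) (w Phi : R -> R) : 0 < T ->
  {within `[0%R, +oo[, continuous Phi} ->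
  (forall x y, 0 < x -> x <= y -> w y <= w x) ->
  (forall x, 0 < x -> 0 <= w x) ->
  (forall t, 0 < t -> `|Phi (t + T) - Phi t| <= w t - w (t + T)) ->
  asymptotically_periodic T Phi.
Proof.
move=> T0 cPhi niw w0 PhiT.
have Tn0 n : 0 <= T *+ n by rewrite mulrn_wge0// ltW.
have PhiTn t n : 0 < t -> `|Phi (t + T *+ n) - Phi t| <= w t - w (t + T *+ n).
  move=> t0; elim: n => [|n ih]; first by rewrite mulr0n addr0 !subrr normr0.
  have := PhiT (t + T *+ n) (ltr_wpDr (Tn0 n) t0).
  rewrite -addrA -mulrSr => h.
  apply: le_trans (ler_distD (Phi (t + T *+ n)) _ _) _; lra.
(* w is within e of its infimum from some point M on *)
have small e : 0 < e -> exists2 M, 0 < M & forall x n, M <= x ->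
    `|Phi (x + T *+ n) - Phi x| <= e.
  move=> e0; pose W := [set w x | x in [set x | 0 < x]].
  have Winf : has_inf W.
    split; first by exists (w 1), 1 => //=.
    by exists 0 => _ [x x0 <-]; exact: w0.
  have [_ [M M0 <-] Me] := inf_adherent e0 Winf.
  exists M => // x n Mx; have x0 := lt_le_trans M0 Mx.
  apply: le_trans (PhiTn x n x0) _.
  have : inf W <= w (x + T *+ n).
    by apply: (ge_inf Winf.2); exists (x + T *+ n) => //=; exact: ltr_wpDr.
  have := niw M x M0 Mx; lra.
pose f1 t := limn (fun n => Phi (t + T *+ n)).
have f1cvg t : (fun n => Phi (t + T *+ n)) @ \oo --> f1 t.
  apply: cauchy_cvg; apply: cauchy_exP => e e0.
  have [M M0 PM] := small (e / 2) (divr_gt0 e0 (ltr0Sn R 1)).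
  have [N MN] := exists_ge_mulrn (M - t) T0.
  exists (Phi (t + T *+ N)); exists N => // n /= Nn.
  rewrite /ball/= distrC -(subnK Nn) addnC mulrnDr addrA.
  apply: le_lt_trans (PM _ _ _) _; [by rewrite -lerBlDl|].
  by rewrite ltr_pdivrMr// ltr_pMr// ltr1n.
have f1Phi e : 0 < e -> exists2 M, 0 < M & forall x, M <= x -> `|Phi x - f1 x| <= e.
  move=> e0; have e20 : 0 < e / 2 by rewrite divr_gt0.
  have [M M0 PM] := small _ e20; exists M => // x Mx.
  have /cvgrPdist_le/(_ _ e20)[N _ /(_ N (leqnn N))/= fN] := f1cvg x.
  have := PM x N Mx; rewrite distrC => PN.
  rewrite distrC in fN.
  apply: le_trans (ler_distD (Phi (x + T *+ N)) _ _) _; lra.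
have f1T : periodic f1 T.
  move=> t; have := f1cvg t; rewrite -(cvg_shiftS _ ) => h.
  apply: cvg_lim => //; apply: cvg_trans h; apply: near_eq_cvg; apply: nearW => n.
  by rewrite /= mulrS addrA.
have f1Tn t n : f1 (t + T *+ n) = f1 t by exact: periodicn.
have f1c : continuous f1.
  move=> t; apply/cvgrPdist_le => e e0.
  have e30 : 0 < e / 3 by rewrite divr_gt0.
  have [M M0 PM] := f1Phi _ e30.
  have [n Mn] := exists_ge_mulrn (M + 1 - t) T0.
  have tn0 : 0 < t + T *+ n by lra.
  have cPhit : {for t + T *+ n, continuous Phi}.
    have : {within `]0%R, +oo[, continuous Phi}.
      by apply: continuous_subspaceW cPhi; apply: subset_itvr; rewrite bnd_simp.
    rewrite continuous_open_subspace; last exact: interval_open.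
    by apply; rewrite inE/= in_itv/= andbT.
  have cPhitn : (fun x => Phi (x + T *+ n)) x @[x --> t] --> Phi (t + T *+ n).
    apply: (@continuous_comp _ _ _ (fun x => x + T *+ n) Phi) => //.
    by apply: cvgD; [exact: cvg_id|exact: cvg_cst].
  move/cvgrPdist_le : cPhitn => /(_ _ e30) cPhitn; near=> x.
  have xt : `|t - x| < 1 by near: x; exact: cvgr_dist_lt.
  have xM : M <= x + T *+ n by move: xt; rewrite ltr_norml => /andP[? ?]; lra.
  have tM : M <= t + T *+ n by lra.
  have Phix : `|Phi (t + T *+ n) - Phi (x + T *+ n)| <= e / 3 by near: x.
  rewrite -(f1Tn t n) -(f1Tn x n).
  have := PM _ xM; have := PM _ tM; move: Phix.
  rewrite !ler_norml => /andP[? ?] /andP[? ?] /andP[? ?]; apply/andP; split; lra.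
have f2c : {within `[0%R, +oo[, continuous (fun x => Phi x - f1 x)}.
  move=> x; apply: cvgB; first exact: cPhi.
  by apply: continuous_subspaceT => y; exact: f1c.
split=> //; exists f1, (fun x => Phi x - f1 x); split => //; last first.
  by move=> t _; rewrite addrC subrK.
split => //.
- have [M M0 PM] := f1Phi 1 ltr01.
  have [c _ cmax] : exists2 c, c \in `[0, M] & forall t, t \in `[0, M] ->
      `|Phi t - f1 t| <= `|Phi c - f1 c|.
    apply: (@EVT_max _ (fun x => `|Phi x - f1 x|)); first exact: ltW.
    move=> x; apply: cvg_norm; move: x.
    by apply: continuous_subspaceW f2c; apply: subset_itvl; rewrite bnd_simp.
  exists (Num.max 1 `|Phi c - f1 c|) => t t0; rewrite le_max.
  have [tM|/ltW Mt] := leP t M.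
    by apply/orP; right; apply: cmax; rewrite in_itv/= t0.
  by rewrite PM.
- apply/cvgrPdist_le => e /f1Phi[M M0 PM]; exists M; split; first exact: num_real.
  by move=> x /ltW Mx /=; rewrite sub0r normrN normr_id PM.
Unshelve. all: by end_near. Qed.

End increments.

(** * The Caputo derivative of a periodic function *)

Section periodicity_and_powers.
Context {R : realType}.

Lemma periodic_derive1n (f : R -> R) (T : R) n :
  periodic f T -> periodic (derive1n n f) T.
Proof.
move=> fT; elim: n => [//|n ih] x.
rewrite -[derive1n n.+1 f]/(derive1 (derive1n n f)) /derive1.
set q := (fun h => _).
have -> : q = (fun h => h^-1 *: (derive1n n f (h + x) - derive1n n f x)).
  by apply/funext => h; rewrite /q addrA !ih.
by [].
Qed.

Lemma powR_nonincreasing (p x y : R) : p <= 0 -> 0 < x -> x <= y -> y `^ p <= x `^ p.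
Proof.
move=> p0 x0 xy; have y0 := lt_le_trans x0 xy.
rewrite -[p]opprK !(powRN _ (- p)) lef_pV2 ?posrE ?powR_gt0//.
by apply: ge0_ler_powR; rewrite ?nnegrE ?oppr_ge0// ltW.
Qed.

End periodicity_and_powers.

Theorem theorem6 (R : realType) (T alpha : R) (n : nat) (f : R -> R)
  (T_gt0 : 0 < T) (alpha_gt0 : 0 < alpha)
  (alpha_n : n%:R - 1 <= alpha < n%:R)
  (f_cont : continuous f) (f_per : periodic f T) (f_AC : AC_n n f)
  (If_bounded : exists M : R, forall t : R, 0 < t ->
     `|frac_integral (n%:R - alpha) f t| <= M)
  (caputo_cont : {within `[0%R, +oo[, continuous (caputo n alpha f)}) :
  asymptotically_periodic T (caputo n alpha f).
Proof.
case: n alpha_n f_AC caputo_cont {If_bounded} => [|n] /andP[].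
  by move=> _ /(lt_trans alpha_gt0); rewrite ltxx.
move=> n_alpha _ [_ /= F_AC] caputo_cont.
set F := derive1n n f in F_AC.
have F_cont : continuous F by exact: abs_continuous_continuous.
have F_per : periodic F T by exact: periodic_derive1n.
set p := n.+1%:R - alpha - 1.
have p_le0 : p <= 0 by rewrite /p; lra.
pose k (x : R) := x `^ p.
have k_noninc x y : 0 < x -> x <= y -> k y <= k x by exact: powR_nonincreasing.
have [g_int] := abs_continuous_upper_derivative (ltW T_gt0) (F_AC _ _ (ltW T_gt0)) F_cont.
rewrite -[X in F X]add0r F_per subrr => g_mean0.
pose C := `|(Gamma (n.+1%:R - alpha))^-1| *
  \int[@lebesgue_measure R]_(s in `[0, T]) `|upper_derivative F s|.
have C_ge0 : 0 <= C by rewrite mulr_ge0// Rintegral_ge0.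
apply: (@asymptotically_periodic_increment _ _ (fun x => C * k x)) => //.
- by move=> x y x0 xy; rewrite ler_wpM2l// k_noninc.
- by move=> x x0; rewrite mulr_ge0// powR_ge0.
- move=> t t0.
  have tT0 : 0 <= t + T by rewrite ltW// addr_gt0.
  rewrite ![caputo _ _ _ _]/(_ * kernel_convolution k (derive1 F) _).
  rewrite !kernel_convolution_derive1 ?(ltW t0)//; last 2 first.
  + exact/F_AC/ltW.
  + exact: F_AC.
  rewrite -mulrBr normrM -mulrBr /C mulrAC -mulrA ler_wpM2l//.
  apply: kernel_convolution_increment => //.
  + exact: (measurable_powR p).
  + exact: measurable_upper_derivative.
  + exact: periodic_upper_derivative.
Qed.
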